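(* Let $p$ be a prime number and $G$ a finite group. Then $G$ has a Sylow $p$-subgroup as a direct factor if and only if $|(xy)^G|=|x^G|\,|y^G|$ for every $p$-element $x\in G$ and every $p'$-element $y\in G$ of prime power order. In particular, $G$ is nilpotent if and only if $|(xy)^G|=|x^G|\,|y^G|$ for every $x,y\in G$ of prime power order with $(o(x),o(y))=1$.
   Context: For $g\in G$, $g^G$ denotes the conjugacy class of $g$ in $G$, $o(g)$ denotes the order of $g$, and $(m,n)$ denotes the greatest common divisor of the integers $m,n$. A $p$-element is an element whose order is a power of $p$; a $p'$-element is an element whose order is not divisible by $p$. *)

(* Defs.v *)
From mathcomp Require Import all_boot all_fingroup all_solvable.

Set Implicit Arguments.
Unset Strict Implicit.
Unset Printing Implicit Defensive.

Local Open Scope group_scope.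

(* The exponent k may be 0, so the identity has prime power order. *)
Definition prime_power_order (gT : finGroupType) (x : gT) : Prop :=
  exists q k : nat, prime q /\ #[x] = (q ^ k)%N.

Definition has_Sylow_direct_factor (p : nat) (gT : finGroupType)
    (G : {group gT}) : Prop :=
  exists P K : {group gT}, p.-Sylow(G) P /\ P \x K = G.

(* Main.v *)
Require Import Defs.
From mathcomp Require Import all_boot all_fingroup all_solvable.

Set Implicit Arguments.
Unset Strict Implicit.
Unset Printing Implicit Defensive.

Local Open Scope group_scope.

(** Everything reduces to comparing centralisers. Always
    ['C_G[x] :&: 'C_G[y] \subset 'C_G[x * y]], and the index of an intersection
    is at most the product of the indices. So if the class of [x * y] has
    [#|x ^: G| * #|y ^: G|] elements, the inclusion must be an equality; but
    [x * y] lies in the larger side, hence centralises [x], and therefore [x] and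
    [y] commute ([commute_card_classM]).

    Thus the class condition forces every [p]-element to commute with every
    [p']-element of prime power order. A Sylow [p]-subgroup [P] is then
    centralised by all Sylow [q]-subgroups with [q != p], so it is normal, and a
    Schur-Zassenhaus complement centralises it: [P] is a direct factor
    ([commute_Sylow_direct_factor]).

    Conversely, if [G = P \x K] then [x] lies in [P] and [y] in [K], so their
    centralisers contain [K] and [P] respectively and have product [G]. The
    index of the intersection is then exactly the product of the indices, and
    the intersection is ['C_G[x * y]] because [x] and [y], having coprime orders,
    are powers of [x * y] ([card_classM_cent]).

    Nilpotency is the direct factor property for all primes at once: if every
    Sylow subgroup is normal, each lies in the Fitting subgroup. *)

Lemma cent1I_subM (gT : finGroupType) (G : {group gT}) (x y : gT) :
  'C_G[x] :&: 'C_G[y] \subset 'C_G[x * y].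
Proof.
apply/subsetP=> z /setIP[/setIP[Gz /cent1P cxz] /setIP[_ /cent1P cyz]].
by rewrite inE Gz; apply/cent1P; apply: commuteM.
Qed.

(** The index of ['C_G[x] :&: 'C_G[y]] is squeezed between [#|(x * y) ^: G|] and
    [#|x ^: G| * #|y ^: G|]. *)
Lemma commute_card_classM (gT : finGroupType) (G : {group gT}) (x y : gT) :
    x \in G -> y \in G ->
  #|(x * y) ^: G| = (#|x ^: G| * #|y ^: G|)%N -> commute x y.
Proof.
move=> Gx Gy eq_cl.
have le_ind: #|G : 'C_G[x] :&: 'C_G[y]| <= #|G : 'C_G[x * y]|.
  rewrite -(Lagrange_index (subsetIl G 'C[x]) (subsetIl _ 'C_G[y])).
  rewrite !index_cent1 eq_cl -index_cent1 leq_mul2l [X in X <= _]indexgI.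
  rewrite -(index_cent1 G y); apply/orP; right.
  exact: subset_leq_card (imsetS _ (subsetIl _ _)).
have eqI: 'C_G[x] :&: 'C_G[y] = 'C_G[x * y].
  apply/eqP; rewrite eqEcard cent1I_subM /=.
  rewrite -(leq_pmul2r (indexg_gt0 G 'C_G[x * y])) Lagrange ?subsetIl //.
  have sIG: 'C_G[x] :&: 'C_G[y] \subset G by rewrite !subIset ?subxx.
  by rewrite -(Lagrange sIG) leq_pmul2l ?cardG_gt0.
have: x * y \in 'C_G[x * y] by rewrite inE groupM // cent1id.
rewrite -eqI => /setIP[/setIP[_ /cent1P cxxy] _].
by apply: (mulgI x); rewrite [RHS]mulgA -cxxy.
Qed.

(** The factorisation of [G] says that [#|G : 'C_G[y]|] is already attained
    inside ['C_G[x]]; the orders are coprime so that ['C_G[x * y]] is no larger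
    than the intersection. *)
Lemma card_classM_cent (gT : finGroupType) (G : {group gT}) (x y : gT) :
    commute x y -> coprime #[x] #[y] -> 'C_G[x] * 'C_G[y] = G ->
  #|(x * y) ^: G| = (#|x ^: G| * #|y ^: G|)%N.
Proof.
move=> cxy co_xy defG.
have eqI: 'C_G[x] :&: 'C_G[y] = 'C_G[x * y].
  apply/eqP; rewrite eqEsubset cent1I_subM -setIIr setIS // -!cent_cycle.
  by rewrite subsetI !centS ?cycleM ?mulG_subl ?mulG_subr.
have CxCy : #|'C_G[x] : 'C_G[y]| = #|y ^: G|.
  apply/eqP; rewrite -index_cent1 -(eqn_pmul2r (cardG_gt0 'C_G[y])).
  by rewrite LagrangeMr defG mulnC Lagrange ?subsetIl.
rewrite -(index_cent1 G (x * y)) -eqI.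
rewrite -(Lagrange_index (subsetIl G 'C[x]) (subsetIl _ _)) index_cent1.
by rewrite indexgI CxCy.
Qed.

(** This holds because a subgroup containing a Sylow [q]-subgroup of [G] for
    every prime [q] has order divisible by [#|G|]. *)
Lemma sub_of_Sylow_sub (gT : finGroupType) (G H : {group gT}) :
    (forall q : nat, prime q -> exists2 S : {group gT},
       q.-Sylow(G) S & S \subset H) ->
  G \subset H.
Proof.
move=> SylH; apply/setIidPl/eqP; rewrite eqEcard subsetIl /=.
apply: dvdn_leq; first exact: cardG_gt0.
apply/(dvdn_partP _ (cardG_gt0 G)) => q; rewrite mem_primes => /andP[q_pr _].
have [S sylS sSH] := SylH q q_pr.
by rewrite -(card_Hall sylS) cardSg // subsetI (pHall_sub sylS).
Qed.

Lemma p_elt_prime_power_order (gT : finGroupType) (q : nat) (x : gT) :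
  prime q -> q.-elt x -> prime_power_order x.
Proof. by move=> q_pr /p_natP[k ox]; exists q, k. Qed.

(** The commutation hypothesis makes any Sylow [p]-subgroup centralised by every
    Sylow [q]-subgroup of [G], and of the complement, for [q != p]. *)
Lemma commute_Sylow_direct_factor (gT : finGroupType) (G : {group gT}) (p : nat) :
    prime p ->
    (forall x y : gT, x \in G -> y \in G ->
       p.-elt x -> p^'.-elt y -> prime_power_order y -> commute x y) ->
  has_Sylow_direct_factor p G.
Proof.
move=> p_pr com; have [P sylP] := Sylow_exists p G.
have sPG := pHall_sub sylP; have pP := pHall_pgroup sylP.
have centP q (S : {group gT}) : prime q -> q != p -> S \subset G ->
    q.-group S -> S \subset 'C(P).
  move=> q_pr neq_qp sSG qS; apply/centsP=> y Sy x Px.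
  apply/commute_sym/com.
  - exact: subsetP Px.
  - exact: subsetP Sy.
  - exact: mem_p_elt Px.
  - by apply: pi_pnat (mem_p_elt qS Sy) _; rewrite !inE.
  - exact: p_elt_prime_power_order (mem_p_elt qS Sy).
have nPG: P <| G.
  rewrite /normal sPG; apply: sub_of_Sylow_sub => q q_pr.
  have [->|neq_qp] := eqVneq q p; first by exists P; rewrite ?normG.
  have [S sylS] := Sylow_exists q G; exists S => //.
  by apply/cents_norm/(centP q); rewrite ?(pHall_sub sylS) ?(pHall_pgroup sylS).
have /splitsP[K complK] := SchurZassenhaus_split (pHall_Hall sylP) nPG.
have p'K: p^'.-Hall(G) K by rewrite -(compl_pHall K sylP).
have [tiPK mulPK] := complP complK.
have sKG := pHall_sub p'K.
have cPK: K \subset 'C(P).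
  apply: sub_of_Sylow_sub => q q_pr; have [S sylS] := Sylow_exists q K.
  have [sSK qS _] := and3P sylS; exists S => //.
  have [eq_qp|neq_qp] := eqVneq q p.
    rewrite -(setIidPl sSK) coprime_TIg ?sub1G //.
    by apply: pnat_coprime (pHall_pgroup p'K); rewrite -eq_qp.
  exact: centP q_pr neq_qp (subset_trans sSK sKG) qS.
by exists P, K; split; last rewrite dprodE.
Qed.

Lemma card_classM_direct_factor (gT : finGroupType) (G : {group gT}) (p : nat)
    (x y : gT) :
    has_Sylow_direct_factor p G ->
    x \in G -> y \in G -> p.-elt x -> p^'.-elt y ->
  #|(x * y) ^: G| = (#|x ^: G| * #|y ^: G|)%N.
Proof.
move=> [P [K [sylP defG]]] Gx Gy px p'y.
have [nPG nKG] := dprod_normal2 defG.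
have p'K: p^'.-Hall(G) K.
  exact/(sdprod_normal_pHallP nKG sylP)/dprodWsdC.
have [_ mulPK cPK _] := dprodP defG.
have Px: x \in P by rewrite (mem_normal_Hall sylP nPG Gx).
have Ky: y \in K by rewrite (mem_normal_Hall p'K nKG Gy).
have Cx_K: K \subset 'C_G[x].
  by rewrite subsetI normal_sub // sub_cent1 (subsetP _ x Px) // centsC.
have Cy_P: P \subset 'C_G[y].
  by rewrite subsetI normal_sub // sub_cent1 (subsetP cPK).
apply: card_classM_cent.
- exact: (centsP (etrans (centsC _ _) cPK)).
- exact: pnat_coprime px p'y.
- apply/eqP; rewrite eqEsubset mul_subG ?subsetIl //=.
  by rewrite -{1}mulPK -(centC cPK) mulgSS.
Qed.

Lemma nilpotent_Sylow_direct_factor (gT : finGroupType) (G : {group gT}) :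
  nilpotent G <-> forall q : nat, prime q -> has_Sylow_direct_factor q G.
Proof.
split=> [nilG q q_pr | dfG].
  exists 'O_q(G)%G, 'O_q^'(G)%G.
  by split; [apply: nilpotent_pcore_Hall | apply: nilpotent_pcoreC].
apply: nilpotentS (Fitting_nil G); apply: sub_of_Sylow_sub => q q_pr.
have [P [K [sylP /dprod_normal2[nPG _]]]] := dfG q q_pr.
by exists P; last exact: Fitting_max nPG (pgroup_nil (pHall_pgroup sylP)).
Qed.

Theorem theorem2p2 (p : nat) (gT : finGroupType) (G : {group gT}) (hp : prime p) :
  (has_Sylow_direct_factor p G <->
     (forall x y : gT, x \in G -> y \in G ->
        p.-elt x -> p^'.-elt y -> prime_power_order y ->
        #|(x * y) ^: G| = (#|x ^: G| * #|y ^: G|)%N))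
  /\
  (nilpotent G <->
     (forall x y : gT, x \in G -> y \in G ->
        prime_power_order x -> prime_power_order y -> coprime #[x] #[y] ->
        #|(x * y) ^: G| = (#|x ^: G| * #|y ^: G|)%N)).
Proof.
split; first split=> [dfG x y Gx Gy px p'y _ | eq_cl].
- exact: card_classM_direct_factor dfG Gx Gy px p'y.
- apply: commute_Sylow_direct_factor => // x y Gx Gy px p'y ppy.
  exact: commute_card_classM Gx Gy (eq_cl x y Gx Gy px p'y ppy).
split=> [/nilpotent_Sylow_direct_factor dfG x y Gx Gy | eq_cl].
  move=> [q [k [q_pr ox]]] _.
  (* For k = 0 the prime q says nothing about y, which may be a q-element. *)
  case: k => [|k] in ox *.
    have -> : x = 1 by apply/eqP; rewrite -order_eq1 ox.
    by rewrite mul1g class1G cards1 mul1n.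
  rewrite ox coprime_pexpl // => co_qy.
  apply: (card_classM_direct_factor (dfG q q_pr) Gx Gy).
    by rewrite /p_elt ox pnatX pnat_id.
  by rewrite /p_elt p'natE // -prime_coprime.
apply/nilpotent_Sylow_direct_factor=> q q_pr.
apply: commute_Sylow_direct_factor => // x y Gx Gy qx q'y ppy.
apply: commute_card_classM Gx Gy (eq_cl x y Gx Gy _ ppy _).
  exact: p_elt_prime_power_order qx.
exact: pnat_coprime qx q'y.
Qed.
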